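(* Let $S$ be a non-empty set and let $(X,E)$ be a connected and locally finite symmetric digraph. Let $(f_x)_{x\in X}$ be a system of functions $f_x\colon S^X\to\mathbb{R}$, considered modulo constant functions, which is uniformly local, i.e. there exists $R>0$ such that for every $x\in X$ the function $f_x$ is local at $x$ with radius $R$. Then the sum $f:=\sum_{x\in X}f_x$ defines a uniform function. That is, for any base state $*\in S$, choosing the representatives of the $f_x$ normalized by $f_x(\star)=0$, the sum $f(\eta)=\sum_{x\in X}f_x(\eta)$ has only finitely many non-zero terms for every $\eta\in S^X_*$, and the resulting function $f$ on $S^X_*$ is uniform.
   Context: A symmetric digraph $(X,E)$ is a set $X$ of vertices with a set $E\subset X\times X$ of edges such that $(x,y)\in E$ iff $(y,x)\in E$. It is locally finite if $\{(x,y)\in E\mid y\in X\}$ is finite for every $x\in X$, and connected if any two vertices are joined by a finite path. $d_X(x,y)$ is the graph distance (length of a shortest path, with $d_X(x,x)=0$). $S^X:=\prod_{x\in X}S$ is the configuration space. A function $f_x\colon S^X\to\mathbb{R}$ is local at $x$ with radius $R$ if the value $f_x(\eta)$ depends only on the components $\eta_z$ with $d_X(x,z)\le R$. For $\Lambda\subset X$, $C(S^\Lambda)$ is the space of real functions on $S^\Lambda$, viewed as functions on $S^X$ (and, below, on $S^X_*$) depending only on the components in $\Lambda$. Let $\mathscr{I}$ be the set of finite subsets of $X$ (including $\emptyset$). For $\Lambda\subset X$, $\operatorname{diam}(\Lambda):=\sup_{x,y\in\Lambda}d_X(x,y)$ (with $\operatorname{diam}(\emptyset)=0$). Fix a base state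 $*\in S$. $S^X_*\subset S^X$ is the set of configurations $\eta$ with $\eta_x=*$ for all but finitely many $x$, and $\star\in S^X_*$ is the configuration with all components equal to $*$. $C(S^X_* )$ is the space of all functions $S^X_*\to\mathbb{R}$. For $f\in C(S^X_* )$ and $\Lambda\subset X$, $\iota^\Lambda_*f(\eta):=f(\eta|_\Lambda)$, where $\eta|_\Lambda$ agrees with $\eta$ on $\Lambda$ and equals $*$ outside $\Lambda$. For $\Lambda\in\mathscr{I}$, $C_\Lambda(S^X_* )$ is the space of $f\in C(S^\Lambda)$ such that $\iota^{\Lambda'}_*f=0$ for every finite $\Lambda'\subset X$ with $\Lambda\not\subset\Lambda'$ (equivalently, $f(\eta)=0$ whenever $\eta_x=*$ for some $x\in\Lambda$). Every $f\in C(S^X_* )$ has a unique expansion $f=\sum_{\Lambda\in\mathscr{I}}f^*_\Lambda$ with $f^*_\Lambda\in C_\Lambda(S^X_* )$ (a finite sum at each $\eta\in S^X_*$). The function $f\in C(S^X_* )$ is uniform if there exists $R>0$ such that $f^*_\Lambda=0$ whenever $\operatorname{diam}(\Lambda)>R$. *)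

(* Defs.v *)
From mathcomp Require Import all_boot all_order all_algebra finmap.
From mathcomp Require Import boolp classical_sets functions cardinality fsbigop.
From mathcomp Require Import reals constructive_ereal ereal.

Set Implicit Arguments.
Unset Strict Implicit.
Unset Printing Implicit Defensive.

Import Order.TTheory GRing.Theory Num.Theory.

Local Open Scope classical_set_scope.
Local Open Scope ring_scope.

Section Digraph.
Variables (R : realType) (X : choiceType).
Implicit Types (E : set (X * X)) (L : set X).

Definition symmetric_digraph E := forall x y, E (x, y) <-> E (y, x).

Definition locally_finite E := forall x, finite_set [set e | E e /\ e.1 = x].

(* A path from x to y, given by the vertices it visits after x; the number of
   its edges is size p, and p = [::] is the path of length 0 from x to x. *)
Definition walk E (x y : X) (p : seq X) : Prop :=
  path (fun u v => (u, v) \in E) x p /\ last x p = y.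

Definition connected_digraph E := forall x y, exists p, walk E x y p.

Definition graph_dist E (x y : X) : \bar R :=
  ereal_inf [set (size p)%:R%:E | p in walk E x y].

(* The supremum of the empty set in \bar R is -oo, whence the case split. *)
Definition diam E L : \bar R :=
  if L == set0 then 0%E
  else ereal_sup [set graph_dist E x y | x in L & y in L].

End Digraph.

Arguments graph_dist {R X} E x y.
Arguments diam {R X} E L.

Section Configurations.
Variables (R : realType) (S : Type) (X : choiceType).

Definition local_at (E : set (X * X)) (r : R) (x : X) (f : (X -> S) -> R) :=
  forall eta eta' : X -> S,
    (forall z, (graph_dist E x z <= r%:E)%E -> eta z = eta' z) ->
    f eta = f eta'.

Definition uniformly_local (E : set (X * X)) (f : X -> (X -> S) -> R) :=
  exists2 r : R, 0 < r & forall x, local_at E r x (f x).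

Variable b : S.

Definition star : X -> S := fun=> b.

(* The representative vanishing at the configuration star of the class of f
   modulo constant functions. *)
Definition normalized (f : (X -> S) -> R) : (X -> S) -> R :=
  fun eta => f eta - f star.

Definition fin_config : Type :=
  {eta : X -> S | finite_set [set x | eta x <> b]}.

Definition config_val (eta : fin_config) : X -> S := sval eta.
Coercion config_val : fin_config >-> Funclass.

Lemma restrict_subproof (L : set X) (eta : fin_config) :
  finite_set [set x | (if x \in L then eta x else b) <> b].
Proof.
by apply: sub_finite_set (svalP eta) => x /=; case: ifP.
Qed.

Definition restrict (L : set X) (eta : fin_config) : fin_config :=
  exist _ (fun x => if x \in L then eta x else b) (restrict_subproof L eta).

Definition iota_star (L : set X) (f : fin_config -> R) : fin_config -> R :=
  fun eta => f (restrict L eta).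

Definition depends_only_on (L : set X) (f : fin_config -> R) :=
  forall eta eta' : fin_config,
    (forall x, L x -> eta x = eta' x) -> f eta = f eta'.

(* For finite L, extension by b identifies C(S^L) with the functions on
   fin_config that depend only on the components in L. *)
Definition CL (L : {fset X}) : set (fin_config -> R) :=
  [set f | depends_only_on [set` L] f /\
     forall L' : set X, finite_set L' -> ~ [set` L] `<=` L' ->
       iota_star L' f = cst 0].

(* The finiteness clause matters: a sum over \in of a family with infinite
   support is 0 by convention. *)
Definition is_expansion (f : fin_config -> R)
    (g : {fset X} -> fin_config -> R) : Prop :=
  (forall L, CL L (g L)) /\
  forall eta, finite_set [set L | g L eta <> 0] /\
    f eta = \sum_(L \in [set: {fset X}]) g L eta.

Lemma fin_config_eq (eta eta' : fin_config) :
  (forall x, eta x = eta' x) -> eta = eta'.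
Proof.
case: eta => e he; case: eta' => e' he' /= ee'.
have {}ee' : e = e' by apply/funext.
by subst e'; congr exist; exact: Prop_irrelevance.
Qed.

Lemma restrict_id (L : set X) (eta : fin_config) :
  (forall x, eta x <> b -> L x) -> restrict L eta = eta.
Proof.
move=> h; apply: fin_config_eq => x /=; case: ifPn => // xL.
apply: esym; apply: contrapT => /h Lx.
by rewrite mem_set in xL.
Qed.

Lemma CL_vanish (L : {fset X}) f (eta : fin_config) x :
  CL L f -> x \in L -> eta x = b -> f eta = 0.
Proof.
move=> [fL f0] xL ex; set L' := [set` L] `\ x.
have nLL' : ~ [set` L] `<=` L' by move=> /(_ x xL) [_ /(_ erefl)].
have fL' : finite_set L' by exact: finite_setD.
have <- : iota_star L' f eta = 0 by rewrite f0.
apply: fL => y /= yL; case: ifPn => // /negP yL'.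
have [->//|yx] := pselect (y = x); by case: yL'; rewrite inE.
Qed.

Lemma CL_sum (g : {fset X} -> fin_config -> R) (eta : fin_config)
    (K : {fset X}) :
  (forall L, CL L (g L)) -> (forall x, eta x <> b -> x \in K) ->
  finite_set [set L | g L eta <> 0] /\
  \sum_(L \in [set: {fset X}]) g L eta = \sum_(M <- fpowerset K) g M eta.
Proof.
move=> gL eK.
have sub L : g L eta <> 0 -> L \in fpowerset K.
  move=> gn0; rewrite fpowersetE; apply/fsubsetP => x xL.
  by apply: eK => ex; apply: gn0; exact: (CL_vanish (gL L) xL).
split; first by apply: sub_finite_set (finite_fset (fpowerset K)) => L /= /sub.
rewrite (@fsbig_seq _ _ _ _ (fpowerset K)) ?fset_uniq//.
apply/esym/fsbig_widen => // L [_ /= LK].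
by apply: contrapT => /sub.
Qed.

Lemma is_expansionP f (g : {fset X} -> fin_config -> R) :
  (forall L, CL L (g L)) ->
  is_expansion f g <->
  forall (L : {fset X}) eta,
    f (restrict [set` L] eta) = \sum_(M <- fpowerset L) g M eta.
Proof.
move=> gL; split=> [[_ fg] L eta|fg].
  have [_ ->] := fg (restrict [set` L] eta).
  have eL x : restrict [set` L] eta x <> b -> x \in L.
    by rewrite /=; case: ifPn => // /set_mem.
  have [_ ->] := CL_sum gL eL.
  apply: eq_big_seq => M; rewrite fpowersetE => /fsubsetP ML.
  by apply: (gL M).1 => x /= /ML xL; rewrite mem_set.
split=> // eta.
have eK x : eta x <> b -> x \in fset_set [set x | eta x <> b].
  by move=> h; rewrite in_fset_set ?inE//; exact: (svalP eta).
have [fin ->] := CL_sum gL eK; split=> //; by rewrite -fg restrict_id.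
Qed.

Lemma expansion_exists f : exists g, is_expansion f g.
Proof.
have [g gE] : exists g : {fset X} -> fin_config -> R, forall (L : {fset X}) eta,
    f (restrict [set` L] eta) = \sum_(M <- fpowerset L) g M eta.
  pose h := fix h n (L : {fset X}) (eta : fin_config) : R :=
    f (restrict [set` L] eta) -
    (if n is m.+1 then \sum_(M <- fpowerset L | M != L) h m M eta else 0).
  have propcard (L M : {fset X}) :
      M \in fpowerset L -> M != L -> (#|` M| < #|` L|)%N.
    by rewrite fpowersetE => ML MnL; rewrite fproper_ltn_card// fproperEneq MnL.
  have hE n : forall m (L : {fset X}) eta, (#|` L| <= n)%N -> (#|` L| <= m)%N ->
      h n L eta = h m L eta.
    elim: n => [|n IH] [|m] L eta //=.
    - rewrite leqn0 => /eqP/cardfs0_eq -> _; congr (_ - _).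
      by rewrite big1_seq// => M; rewrite fpowersetE fsubset0 => /andP[/negPf->].
    - move=> _; rewrite leqn0 => /eqP/cardfs0_eq ->; congr (_ - _).
      by rewrite big1_seq// => M; rewrite fpowersetE fsubset0 => /andP[/negPf->].
    - move=> Ln Lm; congr (_ - _); rewrite big_seq_cond [RHS]big_seq_cond.
      apply: eq_bigr => M /andP[ML /(propcard _ _ ML) lt].
      by apply: IH; rewrite -ltnS (leq_trans lt).
  exists (fun L : {fset X} => h #|` L| L) => L eta.
  rewrite (bigD1_seq L) ?fset_uniq ?fpowersetE ?fsubset_refl//=.
  rewrite (hE _ #|` L|.+1)//= -addrA [X in _ + X]addrC.
  rewrite [X in _ + (X - _)](_ : _ = \sum_(M <- fpowerset L | M != L) h #|` L| M eta).
    by rewrite subrr addr0.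
  rewrite big_seq_cond [RHS]big_seq_cond.
  apply: eq_bigr => M /andP[ML /(propcard _ _ ML) lt].
  by apply: hE => //; exact: ltnW.
have rec (L : {fset X}) eta : g L eta = f (restrict [set` L] eta) -
    \sum_(M <- fpowerset L | M != L) g M eta.
  rewrite gE (bigD1_seq L) ?fset_uniq ?fpowersetE ?fsubset_refl//=.
  by rewrite addrK.
have dep n : forall L : {fset X}, (#|` L| < n)%N -> depends_only_on [set` L] (g L).
  elim: n => // n IH L Ln eta eta' ee'; rewrite !rec.
  congr (_ - _).
    congr f; apply: fin_config_eq => x /=; case: ifPn => // /set_mem xL.
    exact: ee'.
  rewrite big_seq_cond [RHS]big_seq_cond.
  apply: eq_bigr => M /andP[]; rewrite fpowersetE => ML MnL.
  apply: IH => [|x /= xM]; last by apply: ee'; exact: (fsubsetP ML).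
  rewrite -ltnS (leq_trans _ Ln)// ltnS.
  by rewrite fproper_ltn_card// fproperEneq MnL.
have van n : forall (L : {fset X}) (eta : fin_config) x, (#|` L| < n)%N -> x \in L -> eta x = b ->
    g L eta = 0.
  elim: n => // n IH L eta x Ln xL ex; rewrite rec.
  have -> : restrict [set` L] eta = restrict [set` (L `\ x)%fset] eta.
    apply: fin_config_eq => y /=; have [->|yx] := eqVneq y x.
      by rewrite ex; do 2!case: ifP.
    congr (if _ then _ else _); apply/idP/idP => /set_mem /= h; apply/mem_set => /=.
      by rewrite in_fsetD1 yx.
    by move: h; rewrite in_fsetD1 => /andP[].
  rewrite gE.
  rewrite [X in _ - X](bigID (fun M : {fset X} => x \in M)) /=.
  rewrite [X in _ - (X + _)]big1_seq ?add0r; last first.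
    move=> M /andP[/andP[MnL xM]]; rewrite fpowersetE => ML.
    apply: (IH _ _ x) => //.
    rewrite -ltnS (leq_trans _ Ln)// ltnS.
    by rewrite fproper_ltn_card// fproperEneq MnL.
  apply/eqP; rewrite subr_eq0; apply/eqP.
  rewrite -[RHS]big_filter; apply: perm_big; apply: uniq_perm.
  - exact: fset_uniq.
  - by rewrite filter_uniq// fset_uniq.
  move=> M; rewrite mem_filter !fpowersetE fsubsetD1.
  case: (boolP (x \in M)) => xM; first by rewrite !andbF.
  rewrite andbT; case: (boolP (M `<=` L)%fset) => ML; rewrite ?andbF// !andbT.
  by apply/esym; apply: contra xM => /eqP ->.
exists g; apply/is_expansionP => // L; split; first exact: dep.
move=> L' _ LL'; apply/funext => eta; rewrite /iota_star /=.
have [x xL xL'] : exists2 x, x \in L & ~ L' x.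
  by apply: contrapT => h; apply: LL' => x /= xL; apply: contrapT => h'; apply: h; exists x.
apply: (van _ _ _ x (ltnSn _)) => //=.
by rewrite memNset.
Qed.

Lemma expansion_unique f (g g' : {fset X} -> fin_config -> R) :
  is_expansion f g -> is_expansion f g' -> g = g'.
Proof.
move=> eg eg'.
have /(is_expansionP _ eg.1) gE := eg; have /(is_expansionP _ eg'.1) gE' := eg'.
suff H n : forall (L : {fset X}) eta, (#|` L| < n)%N -> g L eta = g' L eta.
  by apply/funext => L; apply/funext => eta; exact: (H _ _ _ (ltnSn _)).
elim: n => // n IH L eta Ln.
have := gE L eta; rewrite gE'.
rewrite !(bigD1_seq L) ?fset_uniq ?fpowersetE ?fsubset_refl//=.
rewrite [X in _ = _ + X](_ : _ = \sum_(M <- fpowerset L | M != L) g' M eta).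
  by move=> /addIr.
rewrite big_seq_cond [RHS]big_seq_cond.
apply: eq_bigr => M /andP[]; rewrite fpowersetE => ML MnL.
apply: IH; rewrite -ltnS (leq_trans _ Ln)// ltnS.
by rewrite fproper_ltn_card// fproperEneq MnL.
Qed.

(* The functions f^*_L of the unique expansion of f. *)
Definition expansion (f : fin_config -> R) : {fset X} -> fin_config -> R :=
  sval (cid (expansion_exists f)).

Lemma expansionP f : is_expansion f (expansion f).
Proof. exact: svalP (cid (expansion_exists f)). Qed.

Definition uniform_function (E : set (X * X)) (f : fin_config -> R) : Prop :=
  exists2 r : R, 0 < r &
    forall L : {fset X}, (r%:E < diam E [set` L])%E -> expansion f L = cst 0.

End Configurations.

Arguments star {S X} b.
Arguments fin_config {S} X b.
Arguments normalized {R S X} b f.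
Arguments uniform_function {R S X b} E f.

(* Main.v *)
Require Import Defs.
From mathcomp Require Import all_boot all_order all_algebra finmap.
From mathcomp Require Import boolp classical_sets functions cardinality fsbigop.
From mathcomp Require Import reals constructive_ereal ereal.

(** Let [r] be a common radius of the [f x].  A site [x] contributes to the sum
    at [eta] only if some [z] within distance [r] of [x] has [eta z <> b]; by
    symmetry of the digraph, [x] then lies in a ball around one of the finitely
    many such [z], and balls are finite by local finiteness
    ([finite_normalized_support]).

    For uniformity, call [erase x eta] the configuration [eta] with [x] reset to
    [b], and consider the mixed difference
      [f eta - f (erase x eta) - f (erase y eta) + f (erase x (erase y eta))].
    In terms of the expansion of [f] it is the sum of the components indexed by
    the sets that contain both [x] and [y].  So when it vanishes identically, an
    induction on the size of the index kills each of these components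
    ([expansion_eq0]).  If [x] and [y] are far apart, no ball of radius [r]
    contains both, so each [f u] ignores one of the two sites and has zero mixed
    difference, and hence so does the sum.  Finally a set of large diameter
    contains two points far apart.

    The radius for the sum is [(r + 1) + (r + 1)] rather than [2 r]: a distance
    at most [r] is an infimum of lengths, and asking only for a walk shorter than
    [r + 1] makes it unnecessary to attain it. *)

Set Implicit Arguments.
Unset Strict Implicit.
Unset Printing Implicit Defensive.

Import Order.TTheory GRing.Theory Num.Theory.

Local Open Scope classical_set_scope.
Local Open Scope ring_scope.

(** * Walks, distances and balls *)

Section Walks.
Context {R : realType} {X : choiceType}.
Implicit Types (E : set (X * X)) (x y z : X).

Lemma walk_cat E x y z p q :
  walk E x y p -> walk E y z q -> walk E x z (p ++ q).
Proof. by move=> [pp <-] [pq <-]; rewrite /walk cat_path last_cat pp. Qed.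

Lemma walk_rev E x y p : symmetric_digraph E -> walk E x y p ->
  exists2 q, walk E y x q & size q = size p.
Proof.
move=> symE [pp <-]; exists (rev (belast x p)); last first.
  by rewrite size_rev size_belast.
split; last by case: p {pp} => //= z p; rewrite rev_cons last_rcons.
rewrite rev_path; move: pp; apply: sub_path => u v /set_mem uv.
by apply/mem_set/symE.
Qed.

Lemma graph_dist_le E x y p :
  walk E x y p -> (graph_dist E x y <= (size p)%:R%:E :> \bar R)%E.
Proof. by move=> wp; apply: ereal_inf_lbound; exists p. Qed.

Lemma short_walk E x y (r : R) : (graph_dist E x y <= r%:E)%E ->
  exists2 p, walk E x y p & (size p)%:R < r + 1.
Proof.
move=> dr; have : (graph_dist E x y < (r + 1)%:E)%E.
  by apply: (le_lt_trans dr); rewrite lte_fin ltrDl.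
by move=> /ereal_inf_lt[_ [p wp <-]]; rewrite lte_fin; exists p.
Qed.

Lemma graph_dist_common E u x y (r : R) : symmetric_digraph E ->
  (graph_dist E u x <= r%:E)%E -> (graph_dist E u y <= r%:E)%E ->
  (graph_dist E x y <= ((r + 1) + (r + 1))%:E)%E.
Proof.
move=> symE /short_walk[p /(walk_rev symE)[p' wp' pp'] pr] /short_walk[q wq qr].
apply: (le_trans (graph_dist_le (walk_cat wp' wq))).
by rewrite lee_fin size_cat natrD pp' ltW// ltrD.
Qed.

Lemma finite_walk_ball E n : locally_finite E -> forall x,
  finite_set [set y | exists2 p, walk E x y p & (size p <= n)%N].
Proof.
move=> lfE; elim: n => [|n IH] x.
  apply: (sub_finite_set _ (finite_set1 x)) => y [[|//] [_ /= <-] _] //.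
(* The first edge of a nonempty walk is one of finitely many. *)
apply: (@sub_finite_set _ _ ([set x] `|`
  \bigcup_(e in [set e | E e /\ e.1 = x])
    [set y | exists2 p, walk E e.2 y p & (size p <= n)%N])).
  move=> y [[[_ /= <-] _|z p [/= /andP[/set_mem xz pp] lp] sp]]; first by left.
  by right; exists (x, z) => //=; exists p.
rewrite finite_setU; split; first exact: finite_set1.
by apply: bigcup_finite; [exact: lfE|move=> e _; exact: IH].
Qed.

(** The centre is the second argument, as the sites to be counted are those
    whose ball contains a given vertex. *)
Lemma finite_ball E y (r : R) : symmetric_digraph E -> locally_finite E ->
  finite_set [set x | (graph_dist E x y <= r%:E)%E].
Proof.
move=> symE lfE.
apply: (sub_finite_set _ (@finite_walk_ball E (Num.truncn (r + 1)) lfE y)).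
move=> x /= /short_walk[p /(walk_rev symE)[q wq qp] pr]; exists q => //.
by rewrite qp -ltnS -(ltr_nat R) (lt_trans pr)// truncnS_gt.
Qed.

Lemma diam_gt E (L : set X) (r : R) : 0 < r -> (r%:E < diam E L)%E ->
  exists x y, [/\ L x, L y & (r%:E < graph_dist E x y)%E].
Proof.
rewrite /diam; case: ifP => _ r0.
  by rewrite lte_fin => /(lt_trans r0); rewrite ltxx.
by move=> /ereal_sup_gt[_ [x Lx [y Ly <-]] xy]; exists x, y.
Qed.

End Walks.

(** * Mixed differences and the expansion *)

Section MixedDifference.
Context {R : realType} {S : Type} {X : choiceType} {b : S}.
Implicit Types (x y : X) (eta : fin_config X b).

Definition erase x eta : fin_config X b := Defs.restrict (~` [set x]) eta.

Lemma erase_same x eta : erase x eta x = b.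
Proof. by rewrite /= memNset// => /(_ erefl). Qed.

Lemma erase_other x z eta : z <> x -> erase x eta z = eta z.
Proof. by move=> zx; rewrite /= mem_set. Qed.

Lemma erase_b x z eta : eta z = b -> erase x eta z = b.
Proof. by rewrite /=; case: ifP. Qed.

Definition mixed_diff (f : fin_config X b -> R) x y eta : R :=
  f eta - f (erase x eta) - f (erase y eta) + f (erase x (erase y eta)).

Lemma mixed_diff_eq0 (f : fin_config X b -> R) (A : set X) x y eta :
  depends_only_on A f -> ~ (A x /\ A y) -> mixed_diff f x y eta = 0.
Proof.
move=> fA nA; rewrite /mixed_diff.
have ignore z eta' : ~ A z -> f (erase z eta') = f eta'.
  by move=> nAz; apply: fA => t At; apply: erase_other => tz; rewrite tz in At.
have [Ax|nAx] := pselect (A x).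
  have nAy : ~ A y by move=> Ay; exact: nA.
  (* As [y] lies outside [A], erasing it first is invisible to [f]. *)
  have -> : f (erase x (erase y eta)) = f (erase x eta).
    apply: fA => t At; have [->|tx] := pselect (t = x); first by rewrite !erase_same.
    by rewrite !erase_other// => ty; apply: nAy; rewrite -ty.
  by rewrite (ignore y)// addrAC subrK subrr.
by rewrite !(ignore x)// subrr sub0r addNr.
Qed.

(** On a component [g M] of an expansion the mixed difference is [g M] itself if
    [M] contains [x] and [y], as the erased configurations are then killed, and
    it is zero otherwise. *)
Lemma mixed_diff_CL (g : fin_config X b -> R) (M : {fset X}) x y eta :
  CL M g ->
  mixed_diff g x y eta = if (x \in M) && (y \in M) then g eta else 0.
Proof.
move=> gM; case: ifPn => [/andP[xM yM]|nM]; last first.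
  by apply: mixed_diff_eq0 gM.1 _ => /= /andP; exact/negP.
rewrite /mixed_diff (CL_vanish gM xM (erase_same x eta)).
rewrite (CL_vanish gM yM (erase_same y eta)).
by rewrite (CL_vanish gM xM (erase_same x _)) !subr0 addr0.
Qed.

Lemma expansion_mixed_diff (f : fin_config X b -> R) (L : {fset X}) x y eta :
  (forall z, eta z <> b -> z \in L) ->
  mixed_diff f x y eta =
  \sum_(M <- fpowerset L | (x \in M) && (y \in M)) expansion f M eta.
Proof.
move=> etaL; have [gL fE] := expansionP f.
have fsum eta' : (forall z, eta z = b -> eta' z = b) ->
    f eta' = \sum_(M <- fpowerset L) expansion f M eta'.
  move=> sub; rewrite (fE eta').2; apply: (CL_sum _ _).2 => // z ez.
  by apply: etaL => /sub.
rewrite {1}/mixed_diff !fsum; try by move=> z ez; rewrite ?erase_b.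
rewrite -!sumrB -big_split/= [RHS]big_mkcond/=.
by apply: eq_bigr => M _; exact: mixed_diff_CL.
Qed.

(** By induction, the proper subsets of [L] containing [x] and [y] contribute
    nothing to the mixed difference at a configuration supported in [L], which
    leaves the component of [L] alone. *)
Lemma expansion_eq0 (f : fin_config X b -> R) x y (L : {fset X}) :
  (forall eta, mixed_diff f x y eta = 0) -> x \in L -> y \in L ->
  expansion f L = cst 0.
Proof.
move=> f0; have [n Ln] := ubnP #|` L|.
elim: n => // n IH in L Ln * => xL yL; apply/funext => eta /=.
have gL := (expansionP f).1 L.
(* Only sites of [L] matter, so [eta] may be taken supported in [L]; then no
   sets other than subsets of [L] occur in the mixed difference. *)
have -> : expansion f L eta = expansion f L (Defs.restrict [set` L] eta).
  by apply: gL.1 => z zL /=; rewrite mem_set.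
set zeta := Defs.restrict _ _.
have zetaL z : zeta z <> b -> z \in L by rewrite /=; case: ifPn => // /set_mem.
have := expansion_mixed_diff f x y zetaL; rewrite f0.
rewrite big_mkcond (bigD1_seq L) ?fset_uniq ?fpowersetE ?fsubset_refl//=.
rewrite xL yL/= big1_seq ?addr0 => [<-//|M /andP[ML]].
rewrite fpowersetE => MsubL; case: ifP => // /andP[xM yM].
have ltM : (#|` M| < n)%N.
  rewrite -ltnS (leq_trans _ Ln)// ltnS.
  by rewrite fproper_ltn_card// fproperEneq ML.
by rewrite (IH M ltM xM yM).
Qed.

End MixedDifference.

(** * Sums of uniformly local functions *)

Section UniformlyLocalSum.
Context {R : realType} {S : Type} {X : choiceType} {b : S} {E : set (X * X)}.
Context {f : X -> (X -> S) -> R} {r : R}.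
Hypothesis symE : symmetric_digraph E.
Hypothesis lfE : locally_finite E.
Hypothesis f_local : forall x, local_at E r x (f x).
Implicit Types (eta : fin_config X b).

Let ball x : set X := [set z | (graph_dist E x z <= r%:E)%E].

Lemma normalized_depends x :
  depends_only_on (ball x) (fun eta => normalized b (f x) eta).
Proof.
by move=> eta eta' ee'; rewrite /normalized; congr (_ - _); exact: f_local.
Qed.

Lemma normalized_eq0 x eta :
  (forall z, ball x z -> eta z = b) -> normalized b (f x) eta = 0.
Proof.
move=> eb; apply/eqP; rewrite subr_eq0; apply/eqP.
by apply: f_local => z /eb.
Qed.

(** One finite set of sites serves for all configurations whose support lies in
    that of [eta], so that the four terms of a mixed difference can be summed
    over the same finite index set. *)
Lemma finite_normalized_support eta : exists K : {fset X},
  forall eta', (forall z, eta z = b -> eta' z = b) ->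
  forall x, normalized b (f x) eta' <> 0 -> x \in K.
Proof.
have finK : finite_set (\bigcup_(z in [set z | eta z <> b])
    [set x | (graph_dist E x z <= r%:E)%E]).
  apply: bigcup_finite; first exact: svalP eta.
  by move=> z _; exact: finite_ball.
exists (fset_set (\bigcup_(z in [set z | eta z <> b])
    [set x | (graph_dist E x z <= r%:E)%E])) => eta' sub x fx.
rewrite in_fset_set ?inE//; apply: contrapT => nK; apply: fx.
apply: normalized_eq0 => z xz; apply: sub; apply: contrapT => ez.
by apply: nK; exists z.
Qed.

(** The triangle inequality excludes that [x] and [y] both lie in the ball of
    some [u], so every summand has zero mixed difference. *)
Lemma mixed_diff_sum_eq0 x y eta :
  ((r + 1 + (r + 1))%:E < graph_dist E x y)%E ->
  mixed_diff (fun eta => \sum_(u \in [set: X]) normalized b (f u) eta) x y eta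
  = 0.
Proof.
move=> xy; have [K etaK] := finite_normalized_support eta.
have fsum eta' : (forall z, eta z = b -> eta' z = b) ->
    \sum_(u \in [set: X]) normalized b (f u) eta' =
    \sum_(u <- K) normalized b (f u) eta'.
  move=> sub; apply: fsbigTE => u uK; apply: contrapT => /(etaK _ sub).
  exact/negP.
rewrite /mixed_diff !fsum; try by move=> z ez; rewrite ?erase_b.
rewrite -!sumrB -big_split/= big1// => u _.
apply: (@mixed_diff_eq0 _ _ _ _ _ _ x y eta (@normalized_depends u)).
move=> -[ux uy].
by have := lt_le_trans xy (graph_dist_common symE ux uy); rewrite ltxx.
Qed.

End UniformlyLocalSum.

Theorem proposition1p1 (R : realType) (S : Type) (X : choiceType)
    (E : set (X * X)) (f : X -> (X -> S) -> R) :
  inhabited S ->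
  symmetric_digraph E -> locally_finite E -> connected_digraph E ->
  uniformly_local E f ->
  forall b : S,
    (forall eta : fin_config X b,
       finite_set [set x | normalized b (f x) eta <> 0]) /\
    uniform_function E
      (fun eta : fin_config X b =>
         \sum_(x \in [set: X]) normalized b (f x) eta).
Proof.
move=> _ symE lfE _ [r r0 f_local] b; split=> [eta|].
  have [K etaK] := finite_normalized_support symE lfE f_local eta.
  by apply: sub_finite_set (finite_fset K) => x; exact: etaK.
have r1_gt0 : 0 < r + 1 + (r + 1) by rewrite !addr_gt0.
exists (r + 1 + (r + 1)) => // L /(diam_gt r1_gt0)[x [y [xL yL xy]]].
apply: (@expansion_eq0 _ _ _ _ _ x y) => // eta.
exact: (mixed_diff_sum_eq0 symE lfE f_local).
Qed.
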